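(* When solving inverse problems using the ALM-PINNs algorithm, assume that the additional data set is noisy with error $\bm{\varepsilon}$: $$\tilde u(\bm{x}^{(i)},t^{(i)}) = u(\bm{x}^{(i)},t^{(i)};\bm{\theta},\bm{v})+\varepsilon^{(i)},\qquad i=1,\dots,N_{\mathcal M},$$ where $\tilde u(\bm{x}^{(i)},t^{(i)})$ is the observed data at $(\bm{x}^{(i)},t^{(i)})$, $u(\bm{x}^{(i)},t^{(i)};\bm{\theta},\bm{v})$ is the predicted data of the neural network function at $(\bm{x}^{(i)},t^{(i)})$, $\varepsilon^{(i)}$ is the error data associated with $(\bm{x}^{(i)},t^{(i)})$, and $N_{\mathcal M}$ is the total number of observations. Then the construction rule of the additional data term $\mathcal{L}_{\mathcal E}^{\mathcal N}(\bm{\theta},\bm{v})$ in the loss function can be described as follows. (1) If $\bm{\varepsilon}\sim N(\bm{0},\sigma^2\bm{I})$, then we choose $$\mathcal{L}_{\mathcal E}^{\mathcal N}(\bm{\theta},\bm{v})=\frac{1}{N_{\mathcal M}}\sum_{i=1}^{N_{\mathcal M}}\frac{\bigl(\tilde u(\bm{x}^{(i)},t^{(i)})-u(\bm{x}^{(i)},t^{(i)};\bm{\theta},\bm{v})\bigr)^2}{2\sigma^2}.$$ Specifically, if $\bm{\varepsilon}\sim N(\bm{0},\tfrac12\bm{I})$, $\mathcal{L}_{\mathcal E}^{\mathcal N}(\bm{\theta},\bm{v})$ takes the $2$-norm form. (2) If $\bm{\varepsilon}\sim \mathrm{Laplace}(\bm{0},2\gamma^2\bm{I})$, then we choose $$\mathcal{L}_{\mathcal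 E}^{\mathcal N}(\bm{\theta},\bm{v})=\frac{1}{N_{\mathcal M}}\sum_{i=1}^{N_{\mathcal M}}\frac{\bigl|\tilde u(\bm{x}^{(i)},t^{(i)})-u(\bm{x}^{(i)},t^{(i)};\bm{\theta},\bm{v})\bigr|}{\gamma}.$$ Specifically, if $\bm{\varepsilon}\sim \mathrm{Laplace}(\bm{0},2\bm{I})$, $\mathcal{L}_{\mathcal E}^{\mathcal N}(\bm{\theta},\bm{v})$ takes the $1$-norm form. (3) If $\bm{\varepsilon}\sim \mathrm{LogN}(\bm{0},\sigma^2\bm{I})$, then we choose $$\mathcal{L}_{\mathcal E}^{\mathcal N}(\bm{\theta},\bm{v})=\frac{1}{N_{\mathcal M}}\sum_{i=1}^{N_{\mathcal M}}\left[\ln\Bigl(\sqrt{2\pi}\,\sigma\bigl(\tilde u(\bm{x}^{(i)},t^{(i)})-u(\bm{x}^{(i)},t^{(i)};\bm{\theta},\bm{v})\bigr)\Bigr)+\frac{\Bigl(\ln\bigl(\tilde u(\bm{x}^{(i)},t^{(i)})-u(\bm{x}^{(i)},t^{(i)};\bm{\theta},\bm{v})\bigr)\Bigr)^2}{2\sigma^2}\right].$$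
   Context: Inverse problem. A function $u(\bm{x},t)$ on $\Omega\times(0,t_T)$, with $\Omega\subset\mathbb{R}^d$ open, satisfies a (possibly nonlinear) partial differential equation written in residual form $\mathcal F=0$, which depends on a parameter vector $\bm{v}$, together with a boundary condition $u=g$ on $\partial\Omega$ and an initial condition $u(\cdot,0)=h$, with $g,h$ known. The parameter $\bm{v}$ is unknown and is to be inferred from an additional data set of (possibly noisy) values $\tilde u(\bm{x}^{(i)},t^{(i)})$ of $u$ at measurement points $(\bm{x}^{(i)},t^{(i)})$ in the domain. Neural network. The solution is approximated by a neural network function with values in $\mathbb{R}$ or $\mathbb{C}$, where $\bm{\theta}\in\mathbb{R}^n$ is the vector of all its weights and biases; $u(\bm{x},t;\bm{\theta},\bm{v})$ denotes its prediction at $(\bm{x},t)$ in the inverse problem, where $\bm{v}$ is trained together with $\bm{\theta}$. ALM-PINNs algorithm (physics-informed neural networks with the augmented Lagrangian multiplier method). For the inverse problem it treats the boundary and initial terms as the objective to be minimized and the equation term and the data term as constraints $\mathcal L_{\mathcal F}^{\mathcal N}(\bm{\theta},\bm{v})=0$, $\mathcal L_{\mathcal E}^{\mathcal N}(\bm{\theta},\bm{v})=0$, using the loss function $$\mathcal L_{\mathcal B}^{\mathcal N}(\bm{\theta})+\mathcal L_{\mathcal I}^{\mathcal N}(\bm{\theta})+\lambda_{\mathcal F}\mathcal L_{\mathcal F}^{\mathcal N}(\bm{\theta},\bm{v})+\lambda_{\mathcal E}\mathcal L_{\mathcal E}^{\mathcal N}(\bm{\theta},\bm{v})+\tfrac{\mu_{\mathcal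 F}}{2}|\mathcal L_{\mathcal F}^{\mathcal N}(\bm{\theta},\bm{v})|^2+\tfrac{\mu_{\mathcal E}}{2}|\mathcal L_{\mathcal E}^{\mathcal N}(\bm{\theta},\bm{v})|^2 .$$ Here $\mathcal L_{\mathcal F}^{\mathcal N},\mathcal L_{\mathcal B}^{\mathcal N},\mathcal L_{\mathcal I}^{\mathcal N}$ are the squared norms of the residuals of the network function in the equation, the boundary condition and the initial condition (the norm of $H^2(0,T;H^2(\Omega))$ for the first two, that of $H^2(\Omega)$ for the third), $\lambda_{\mathcal F},\lambda_{\mathcal E}$ are Lagrange multipliers and $\mu_{\mathcal F},\mu_{\mathcal E}$ are penalty parameters. $\mathcal L_{\mathcal E}^{\mathcal N}$ is the term for the additional data set, and the statement is the rule by which this term is chosen according to the distribution of the error. Error distributions. $\bm{\varepsilon}=(\varepsilon^{(1)},\dots,\varepsilon^{(N_{\mathcal M})})$, with $\sigma,\gamma>0$; each component has the following density $f$: - $N(\bm{0},\sigma^2\bm{I})$ (normal, mean $0$, standard deviation $\sigma$): $f(s)=\frac{1}{\sigma\sqrt{2\pi}}\exp\bigl(-\frac{s^2}{2\sigma^2}\bigr)$; - $\mathrm{Laplace}(\bm{0},2\gamma^2\bm{I})$ (mean $0$, variance $2\gamma^2$): $f(s)=\frac{1}{2\gamma}\exp\bigl(-\frac{|s|}{\gamma}\bigr)$; - $\mathrm{LogN}(\bm{0},\sigma^2\bm{I})$ (log-normal with parameters $0$ and $\sigma^2$): $f(s)=\frac{1}{\sqrt{2\pi}\,\sigma s}\exp\bigl(-\frac{(\ln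 s)^2}{2\sigma^2}\bigr)$ for $s>0$ and $f(s)=0$ for $s\le 0$. The expressions ''$2$-norm form'' and ''$1$-norm form'' are names for what the formulas in (1) and (2) become when $2\sigma^2=1$ and $\gamma=1$, respectively. *)

(* Defs.v *)
From mathcomp Require Export all_boot all_order all_algebra.
From mathcomp Require Export all_classical all_reals all_analysis.
From mathcomp Require Export complex.

Set Implicit Arguments.
Unset Strict Implicit.
Unset Printing Implicit Defensive.

Import Order.TTheory GRing.Theory Num.Theory.
Import numFieldTopology.Exports numFieldNormedType.Exports.

Local Open Scope classical_set_scope.
Local Open Scope ring_scope.
Local Open Scope complex_scope.

Section densities.
Context {R : realType}.

(* The normal density with mean 0 and standard deviation sigma is
   [normal_pdf 0 sigma]. *)

Definition laplace_pdf (gamma s : R) : R :=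
  (2 * gamma)^-1 * expR (- `|s| / gamma).

Definition lognormal_pdf (sigma s : R) : R :=
  if 0 < s then
    (Num.sqrt (2 * pi) * sigma * s)^-1 *
      expR (- (ln s ^+ 2) / (2 * sigma ^+ 2))
  else 0.

End densities.

Section random_errors.
Context {R : realType} {disp : measure_display} {T : measurableType disp}.
Variables (P : probability T R) (N : nat).

(* The components of eps are independent and each has density f with respect
   to the Lebesgue measure: a law on R^N is determined by its values on the
   boxes B_1 x ... x B_N, where this joint density factorizes. *)
Definition iid_with_density (eps : 'I_N -> {RV P >-> R}) (f : R -> R) : Prop :=
  forall B : 'I_N -> set R, (forall i, measurable (B i)) ->
    P [set w | forall i, B i (eps i w)] =
      \big[*%E/1%E]_(i < N) (\int[lebesgue_measure]_(s in B i) (f s)%:E)%E.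

Definition normal_error (eps : 'I_N -> {RV P >-> R}) (sigma : R) : Prop :=
  iid_with_density eps (normal_pdf 0 sigma).

(* variance 2 * gamma ^+ 2 *)
Definition laplace_error (eps : 'I_N -> {RV P >-> R}) (gamma : R) : Prop :=
  iid_with_density eps (laplace_pdf gamma).

Definition lognormal_error (eps : 'I_N -> {RV P >-> R}) (sigma : R) : Prop :=
  iid_with_density eps (lognormal_pdf sigma).

(* g i is the density of X i with respect to the product, on R[i] = R x R, of
   the Lebesgue measure (real parts) and the counting measure (imaginary
   parts), and the X i are independent: real errors added to a complex number
   a stay on the horizontal line through a. For real data (all imaginary parts
   zero) this is the usual density with respect to the Lebesgue measure. *)
Definition has_joint_density (X : 'I_N -> T -> R[i]) (g : 'I_N -> R[i] -> R) :
    Prop :=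
  forall (h : 'I_N -> R) (B : 'I_N -> set R), (forall i, measurable (B i)) ->
    P [set w | forall i, complex.Im (X i w) = h i /\ B i (complex.Re (X i w))] =
      \big[*%E/1%E]_(i < N)
        (\int[lebesgue_measure]_(s in B i) (g i (s +i* h i))%:E)%E.

End random_errors.

(* Th and Vp are the types of the network parameters theta and of the equation
   parameters v; [pred i theta v] is the network prediction at the i-th
   measurement point. Values are in R[i], which contains the real-valued case. *)
Section data_term.
Context {R : realType} {N : nat} {Th Vp : Type}.
Variable pred : 'I_N -> Th -> Vp -> R[i].

Definition noisy_data {disp : measure_display} {T : measurableType disp}
    {P : probability T R} (eps : 'I_N -> {RV P >-> R}) (theta : Th) (v : Vp)
    (X : 'I_N -> T -> R[i]) : Prop :=
  forall i w, X i w = pred i theta v + (eps i w)%:C.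

(* Since the errors are real, only parameters at which all the differences
   between data and predictions are real can have produced the data y; there
   [residual] is that difference. For real-valued networks and data this holds
   for all parameters, see [real_valued_difference]. *)
Definition real_difference (y : 'I_N -> R[i]) (theta : Th) (v : Vp) : Prop :=
  forall i, complex.Im (y i - pred i theta v) = 0.

Definition residual (y : 'I_N -> R[i]) (theta : Th) (v : Vp) (i : 'I_N) : R :=
  complex.Re (y i - pred i theta v).

Lemma real_valued_difference (q : 'I_N -> Th -> Vp -> R) (z : 'I_N -> R)
    (theta : Th) (v : Vp) :
  (forall i, pred i theta v = (q i theta v)%:C) ->
  real_difference (fun i => (z i)%:C) theta v /\
  forall i, residual (fun i => (z i)%:C) theta v i = z i - q i theta v.
Proof.
by move=> hq; split=> i; rewrite /residual hq ?raddfB /= ?subr0.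
Qed.

Definition observation_density (f : R -> R) (theta : Th) (v : Vp) (i : 'I_N)
    (z : R[i]) : R :=
  if complex.Im (z - pred i theta v) == 0
  then f (complex.Re (z - pred i theta v)) else 0.

Definition likelihood (f : R -> R) (y : 'I_N -> R[i]) (theta : Th) (v : Vp) : R :=
  \prod_(i < N) observation_density f theta v i (y i).

Definition mean_neg_log_likelihood (f : R -> R) (y : 'I_N -> R[i])
    (theta : Th) (v : Vp) : R :=
  - (N%:R^-1 * ln (likelihood f y theta v)).

Definition maximizes (L : Th -> Vp -> R) (theta : Th) (v : Vp) : Prop :=
  forall theta' v', L theta' v' <= L theta v.

Definition minimizes_on (D : Th -> Vp -> Prop) (L : Th -> Vp -> R)
    (theta : Th) (v : Vp) : Prop :=
  D theta v /\ forall theta' v', D theta' v' -> L theta v <= L theta' v'.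

(* The term LE, meaningful on D, is the one given by maximum likelihood for the
   data y and the error density f: D is where the likelihood is positive, LE is
   there the mean negative log-likelihood minus a constant c that does not
   depend on the parameters, and minimizing LE is maximizing the likelihood. *)
Definition maximum_likelihood_term (f : R -> R) (y : 'I_N -> R[i])
    (D : Th -> Vp -> Prop) (c : R) (LE : Th -> Vp -> R) : Prop :=
  [/\ forall theta v, 0 < likelihood f y theta v <-> D theta v,
      forall theta v, D theta v ->
        LE theta v = mean_neg_log_likelihood f y theta v - c &
      (exists theta v, D theta v) -> forall theta v,
        maximizes (likelihood f y) theta v <-> minimizes_on D LE theta v].

(* The terms for the data set, as functions of the N differences r between data
   and predictions. [ln] is 0 on nonpositive arguments: [lognormal_term] is
   only meaningful for positive r. *)

Definition normal_term (sigma : R) (r : 'I_N -> R) : R :=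
  N%:R^-1 * \sum_(i < N) r i ^+ 2 / (2 * sigma ^+ 2).

Definition laplace_term (gamma : R) (r : 'I_N -> R) : R :=
  N%:R^-1 * \sum_(i < N) `|r i| / gamma.

Definition lognormal_term (sigma : R) (r : 'I_N -> R) : R :=
  N%:R^-1 * \sum_(i < N)
    (ln (Num.sqrt (2 * pi) * sigma * r i) + ln (r i) ^+ 2 / (2 * sigma ^+ 2)).

Definition two_norm_term (r : 'I_N -> R) : R := N%:R^-1 * \sum_(i < N) r i ^+ 2.

Definition one_norm_term (r : 'I_N -> R) : R := N%:R^-1 * \sum_(i < N) `|r i|.

End data_term.

(* X and Y stand for H^2(0,T; H^2(Omega)) and H^2(Omega), and resF, resB, resI
   for the residuals of the network in the equation, the boundary condition and
   the initial condition. *)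
Definition alm_loss {R : realType} {X Y : normedModType R} {Th Vp : Type}
    (resF : Th -> Vp -> X) (resB : Th -> X) (resI : Th -> Y)
    (lamF lamE muF muE : R) (LE : Th -> Vp -> R) (theta : Th) (v : Vp) : R :=
  let LF := `|resF theta v| ^+ 2 in
  `|resB theta| ^+ 2 + `|resI theta| ^+ 2
  + lamF * LF + lamE * LE theta v
  + muF / 2 * `|LF| ^+ 2 + muE / 2 * `|LE theta v| ^+ 2.

(* The rule for the term of the data set in the loss function, for errors with
   density f: the data have the joint density whose value at the observations
   is the likelihood, [term] (a function of the differences) is given by maximum
   likelihood, and the loss function is the one built from the mean negative
   log-likelihood minus the constant c. [loss] is the loss function as a
   function of its data term. *)
Definition data_term_rule {R : realType} {disp : measure_display}
    {T : measurableType disp} {P : probability T R} {N : nat} {Th Vp : Type}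
    (pred : 'I_N -> Th -> Vp -> R[i])
    (loss : (Th -> Vp -> R) -> Th -> Vp -> R)
    (eps : 'I_N -> {RV P >-> R}) (f : R -> R)
    (D : ('I_N -> R[i]) -> Th -> Vp -> Prop) (c : R)
    (term : ('I_N -> R) -> R) : Prop :=
  (forall theta v X, noisy_data pred eps theta v X ->
     has_joint_density P X (observation_density pred f theta v)) /\
  (forall y : 'I_N -> R[i],
     let LE := fun theta v => term (residual pred y theta v) in
     maximum_likelihood_term pred f y (D y) c LE /\
     (forall theta v, D y theta v ->
        loss LE theta v =
        loss (fun theta' v' =>
                mean_neg_log_likelihood pred f y theta' v' - c) theta v)).

(* Main.v *)
Require Import Defs.
From mathcomp Require Import all_boot all_order all_algebra ring.
From mathcomp Require Import all_classical all_reals all_analysis complex.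
From mathcomp Require Import measurable_realfun.

Import Order.TTheory GRing.Theory Num.Theory.
Import numFieldTopology.Exports numFieldNormedType.Exports.

Local Open Scope classical_set_scope.
Local Open Scope ring_scope.
Local Open Scope complex_scope.

(** The three cases have the same proof, carried out once in
    [data_term_rule_of_density] for an arbitrary measurable density [f >= 0].

    Data: at fixed parameters the data are the errors translated by the
    predictions, so a box condition on the data is a box condition on the errors
    with each side translated. As the Lebesgue measure is translation invariant
    ([ge0_integral_translate]), the integral of [f] over a translated side is
    the integral over the original side of [f] evaluated at the difference
    between data and prediction, which is the observation density
    ([noisy_data_joint_density]).

    Likelihood: it is a product of nonnegative factors, hence positive exactly
    when all factors are, that is, when all differences are real and lie where
    [f] is positive ([likelihood_gt0]). There the logarithm turns the product
    into a sum; if [- ln f = l + c] with [c] constant, the mean negative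
    log-likelihood is the mean of [l] over the differences, plus [c]
    ([mean_neg_log_likelihoodE]). Since [ln] is increasing, minimizing this mean
    where the likelihood is positive is maximizing the likelihood: a point where
    the likelihood vanishes is not a maximizer as soon as it is positive
    somewhere ([maximum_likelihood_termP]).

    Densities: where it is positive, each of the three has the form
    [k^-1 * exp (- x)], with negative logarithm [x + ln k] ([neg_ln_div_expR]). For the normal and the Laplace
    densities [k] does not depend on the argument and [ln k] is the constant
    [c]; for the log-normal density [k] contains the argument, so [ln k] stays
    in the term and [c = 0]. *)

(** * Translated densities *)

(** Translates of half-open intervals have the same length, and the Lebesgue
    measure is determined by its values on such intervals. *)
Lemma lebesgue_measure_translate {R : realType} (a : R) (A : set R) :
  measurable A -> lebesgue_measure ((fun r : R => r + a) @^-1` A) =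
                  lebesgue_measure A.
Proof.
move=> mA.
pose phi (r : measurableTypeR R) : measurableTypeR R := r + a.
have mphi : measurable_fun setT phi by exact: measurable_funD.
have := @lebesgue_measure_unique R (pushforward lebesgue_measure phi).
move=> /(_ mphi _ A mA) -> //.
move=> _ [[b c] _ <-] /=.
rewrite /pushforward/=.
have -> : phi @^-1` `]b, c] = `]b - a, c - a]%classic.
  by apply/seteqP; split=> r /=; rewrite !in_itv/= ltrBlDr lerBrDr.
rewrite !lebesgue_measure_itv/= !lte_fin ltrD2r.
by case: ifP => // _; rewrite -!EFinB; congr _%:E; ring.
Qed.

Lemma ge0_integral_translate {R : realType} (a : R) (f : R -> R) (B : set R) :
  measurable_fun setT f -> (forall s, 0 <= f s) -> measurable B ->
  (\int[lebesgue_measure]_(s in B) (f (s - a))%:E =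
   \int[lebesgue_measure]_(r in (fun r : R => (r + a)%R) @^-1` B) (f r)%:E)%E.
Proof.
move=> mf f0 mB.
pose phi (r : measurableTypeR R) : measurableTypeR R := r + a.
have mphi : measurable_fun setT phi by exact: measurable_funD.
pose mu := @lebesgue_measure R.
transitivity (\int[pushforward mu phi]_(s in B) (f (s - a))%:E)%E.
  apply: eq_measure_integral => A mA _.
  by exact/esym/lebesgue_measure_translate.
rewrite ge0_integral_pushforward//.
- by apply: eq_integral => r _ /=; rewrite /phi addrK.
- apply/measurable_EFinP; apply: measurable_funTS.
  by apply: measurableT_comp => //; exact: measurable_funB.
- by move=> s _; rewrite lee_fin.
Qed.

(** If the prescribed imaginary parts are those of the predictions, the event on
    the data is a box condition on the errors; otherwise it is empty, and the
    factor at an index of disagreement vanishes. *)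
Lemma noisy_data_joint_density (R : realType) (disp : measure_display)
    (T : measurableType disp) (P : probability T R) (N : nat) (Th Vp : Type)
    (pred : 'I_N -> Th -> Vp -> R[i]) (eps : 'I_N -> {RV P >-> R})
    (f : R -> R) (theta : Th) (v : Vp) (X : 'I_N -> T -> R[i]) :
  measurable_fun setT f -> (forall s, 0 <= f s) -> iid_with_density eps f ->
  noisy_data pred eps theta v X ->
  has_joint_density P X (observation_density pred f theta v).
Proof.
move=> mf f0 epsf Xeps h B mB.
pose p i := pred i theta v.
have ImX i w : complex.Im (X i w) = complex.Im (p i).
  by rewrite Xeps raddfD/= addr0.
have ReX i w : complex.Re (X i w) = eps i w + complex.Re (p i).
  by rewrite Xeps raddfD/= addrC.
have [hp|/existsNP[i hi]] := pselect (forall i, complex.Im (p i) = h i).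
  transitivity (P [set w | forall i,
      ((fun r : R => r + complex.Re (p i)) @^-1` B i) (eps i w)]).
    congr (P _); apply/seteqP; split=> w /= Bw i; have := Bw i; rewrite ReX.
      by case.
    by move=> ?; split=> //; rewrite ImX hp.
  rewrite (epsf (fun i => (fun r : R => r + complex.Re (p i)) @^-1` B i)).
    apply: eq_bigr => i _; rewrite -ge0_integral_translate//.
    apply: eq_integral => s _; rewrite /observation_density !raddfB/=.
    by rewrite -/(p i) hp subrr eqxx.
  move=> i; rewrite -[X in measurable X]setTI.
  by apply: (measurable_funD (@measurable_id _ _ _) (measurable_cst _)).
transitivity (0%E : \bar R).
  rewrite -(measure0 P); congr (P _); apply/seteqP; split=> // w /= /(_ i)[].
  by rewrite ImX.
rewrite (bigD1 i)//= [X in (X * _)%E]integral0_eq ?mul0e// => s _.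
rewrite /observation_density raddfB/= -/(p i) subr_eq0 ifF//.
by apply/negbTE/eqP => /esym.
Qed.

(** * Maximum likelihood *)

Lemma ln_prod {R : realType} {I : Type} (s : seq I) (F : I -> R) :
  (forall i, 0 < F i) -> ln (\prod_(i <- s) F i) = \sum_(i <- s) ln (F i).
Proof.
move=> F_gt0.
(* Positivity of the partial products is carried along: [ln] turns products
   into sums only for positive factors. *)
suff [] : 0 < \prod_(i <- s) F i /\
          ln (\prod_(i <- s) F i) = \sum_(i <- s) ln (F i) by [].
apply: (big_ind2 (fun p q => 0 < p /\ ln p = q)) => //; first by rewrite ln1.
by move=> p q p' q' [p0 <-] [p'0 <-]; rewrite mulr_gt0// lnM// posrE.
Qed.

Section maximum_likelihood.
Context {R : realType} {N : nat} {Th Vp : Type}.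
Variables (pred : 'I_N -> Th -> Vp -> R[i]) (f : R -> R).
Hypothesis f_ge0 : forall s, 0 <= f s.

Lemma observation_density_ge0 theta v i z :
  0 <= observation_density pred f theta v i z.
Proof. by rewrite /observation_density; case: ifP. Qed.

(** This identifies the domain of the data term: only there is the logarithm of
    the likelihood meaningful. *)
Lemma likelihood_gt0 y theta v :
  0 < likelihood pred f y theta v <->
  real_difference pred y theta v /\
  forall i, 0 < f (residual pred y theta v i).
Proof.
split=> [L_gt0|[yr fr]].
  have obs_gt0 i : 0 < observation_density pred f theta v i (y i).
    rewrite lt_def observation_density_ge0 andbT; apply: contraTneq L_gt0 => o0.
    by rewrite /likelihood (bigD1 i)//= o0 mul0r ltxx.
  split=> i; have := obs_gt0 i; rewrite /observation_density.
    by case: ifP => [/eqP//|_]; rewrite ltxx.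
  by case: ifP => // _; rewrite ltxx.
by apply: prodr_gt0 => i _; rewrite /observation_density yr eqxx; exact: fr.
Qed.

(** Each of the [N] observations contributes one copy of the constant [c] to the
    negative log-likelihood, so the mean contains exactly one. *)
Lemma mean_neg_log_likelihoodE (c : R) (l : R -> R) y theta v :
  (0 < N)%N ->
  (forall s, 0 < f s -> - ln (f s) = l s + c) ->
  0 < likelihood pred f y theta v ->
  mean_neg_log_likelihood pred f y theta v =
  N%:R^-1 * \sum_(i < N) l (residual pred y theta v i) + c.
Proof.
move=> N_gt0 lE /likelihood_gt0[yr fr].
rewrite /mean_neg_log_likelihood.
have -> : likelihood pred f y theta v =
    \prod_(i < N) f (residual pred y theta v i).
  by apply: eq_bigr => i _; rewrite /observation_density yr eqxx.
rewrite ln_prod// -mulrN -sumrN.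
rewrite (eq_bigr _ (fun i _ => lE _ (fr i))) big_split/= mulrDr; congr (_ + _).
by rewrite sumr_const card_ord -[c *+ N]mulr_natl mulKf// pnatr_eq0 -lt0n.
Qed.

(** On its domain [LE] is a decreasing function of the likelihood, and outside
    the likelihood is 0, below every value that it takes on the domain. *)
Lemma maximum_likelihood_termP (c : R) (LE : Th -> Vp -> R) y :
  (0 < N)%N ->
  (forall theta v, 0 < likelihood pred f y theta v ->
     LE theta v = mean_neg_log_likelihood pred f y theta v - c) ->
  forall D : Th -> Vp -> Prop,
  (forall theta v, 0 < likelihood pred f y theta v <-> D theta v) ->
  maximum_likelihood_term pred f y D c LE.
Proof.
move=> N_gt0 LEE D DE; split=> // [theta v /DE/LEE//|[theta0 [v0 /DE L0]]].
have LE_le theta v theta' v' : 0 < likelihood pred f y theta v ->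
    0 < likelihood pred f y theta' v' ->
    (LE theta v <= LE theta' v') =
    (likelihood pred f y theta' v' <= likelihood pred f y theta v).
  move=> L_gt0 L'_gt0; rewrite !LEE// lerD2r lerN2 ler_pM2l ?invr_gt0 ?ltr0n//.
  by rewrite ler_ln ?posrE.
move=> theta v; split=> [Lmax|[/DE L_gt0 LEmin] theta' v'].
  have L_gt0 : 0 < likelihood pred f y theta v.
    exact: lt_le_trans L0 (Lmax _ _).
  by split=> [|theta' v' /DE L'_gt0]; [exact/DE|rewrite LE_le].
have [L'_gt0|] := ltP 0 (likelihood pred f y theta' v').
  by rewrite -LE_le//; apply/LEmin/DE.
by move=> /le_trans; apply; exact: ltW.
Qed.

End maximum_likelihood.

(** The function [l] is the part of [- ln f] kept in the data term. The term is
    tied to the likelihood on [D] only, so the two losses agree on [D] because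
    the loss at a point depends on the data term through its value there. *)
Lemma data_term_rule_of_density {R : realType} {disp : measure_display}
    {T : measurableType disp} {P : probability T R} {N : nat} {Th Vp : Type}
    {pred : 'I_N -> Th -> Vp -> R[i]}
    {loss : (Th -> Vp -> R) -> Th -> Vp -> R} {eps : 'I_N -> {RV P >-> R}}
    {f l : R -> R} {D : ('I_N -> R[i]) -> Th -> Vp -> Prop} {c : R}
    {term : ('I_N -> R) -> R} :
  (0 < N)%N ->
  (forall LE LE' theta v, LE theta v = LE' theta v ->
     loss LE theta v = loss LE' theta v) ->
  measurable_fun setT f -> (forall s, 0 <= f s) ->
  (forall s, 0 < f s -> - ln (f s) = l s + c) ->
  (forall r, term r = N%:R^-1 * \sum_(i < N) l (r i)) ->
  (forall y theta v, D y theta v <->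
     real_difference pred y theta v /\
     forall i, 0 < f (residual pred y theta v i)) ->
  iid_with_density eps f ->
  data_term_rule pred loss eps f D c term.
Proof.
move=> N_gt0 loss_local mf f0 lE termE DE epsf.
split=> [theta v X|y LE]; first exact: noisy_data_joint_density.
have L_gt0 theta v : 0 < likelihood pred f y theta v <-> D y theta v.
  exact: iff_trans (likelihood_gt0 pred f f0 y theta v)
                   (iff_sym (DE y theta v)).
have LEE theta v : 0 < likelihood pred f y theta v ->
    LE theta v = mean_neg_log_likelihood pred f y theta v - c.
  by move=> ?; rewrite (mean_neg_log_likelihoodE pred f f0 c l)// addrK /LE termE.
split; first exact: maximum_likelihood_termP.
by move=> theta v /L_gt0/LEE; exact: loss_local.
Qed.

(** * The three error densities *)

Section densities.
Context {R : realType}.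
Implicit Types sigma gamma s : R.

Lemma neg_ln_div_expR (k x : R) : 0 < k ->
  - ln (k^-1 * expR (- x)) = x + ln k.
Proof.
move=> k0; rewrite [in LHS]lnM ?posrE ?invr_gt0 ?expR_gt0// lnV ?posrE//.
by rewrite expRK opprD !opprK addrC.
Qed.

Lemma normal_pdf_gt0 sigma s : 0 < sigma -> 0 < normal_pdf 0 sigma s.
Proof.
move=> sigma0; have sigmaN0 := lt0r_neq0 sigma0.
by rewrite normal_pdfE// mulr_gt0 ?normal_peak_gt0 ?expR_gt0.
Qed.

Lemma neg_ln_normal_pdf sigma s : 0 < sigma ->
  - ln (normal_pdf 0 sigma s) =
  s ^+ 2 / (2 * sigma ^+ 2) + ln (sigma * Num.sqrt (2 * pi)).
Proof.
move=> sigma0; have sigmaN0 := lt0r_neq0 sigma0.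
rewrite normal_pdfE// /normal_peak /normal_fun subr0 mulNr neg_ln_div_expR.
  rewrite -[sigma ^+ 2 *+ 2]mulr_natl; congr (_ + ln _).
  have -> : sigma ^+ 2 * pi *+ 2 = sigma ^+ 2 * (2 * pi) by ring.
  by rewrite sqrtrM ?sqr_ge0// sqrtr_sqr gtr0_norm.
by rewrite -invr_gt0 normal_peak_gt0.
Qed.

Lemma laplace_pdf_gt0 gamma s : 0 < gamma -> 0 < laplace_pdf gamma s.
Proof.
by move=> gamma0; rewrite mulr_gt0 ?expR_gt0// invr_gt0 mulr_gt0.
Qed.

Lemma neg_ln_laplace_pdf gamma s : 0 < gamma ->
  - ln (laplace_pdf gamma s) = `|s| / gamma + ln (2 * gamma).
Proof.
by move=> gamma0; rewrite /laplace_pdf mulNr neg_ln_div_expR// mulr_gt0.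
Qed.

Lemma measurable_laplace_pdf gamma : measurable_fun setT (laplace_pdf gamma).
Proof.
apply: measurable_funM => //; apply: measurableT_comp => //.
apply: measurable_funM => //; apply: measurableT_comp => //.
Qed.

Lemma lognormal_pdf_gt0 sigma s : 0 < sigma ->
  (0 < lognormal_pdf sigma s) = (0 < s).
Proof.
move=> sigma0; rewrite /lognormal_pdf; have [s0|_] := ltP 0 s; last first.
  by rewrite ltxx.
rewrite mulr_gt0 ?expR_gt0// invr_gt0 !mulr_gt0// sqrtr_gt0.
by rewrite mulr_gt0 ?pi_gt0.
Qed.

Lemma lognormal_pdf_ge0 sigma s : 0 < sigma -> 0 <= lognormal_pdf sigma s.
Proof.
move=> sigma0; have [s0|s0] := ltP 0 s; last by rewrite /lognormal_pdf ltNge s0.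
by rewrite ltW// lognormal_pdf_gt0.
Qed.

Lemma neg_ln_lognormal_pdf sigma s : 0 < sigma -> 0 < s ->
  - ln (lognormal_pdf sigma s) =
  ln (Num.sqrt (2 * pi) * sigma * s) + ln s ^+ 2 / (2 * sigma ^+ 2).
Proof.
move=> sigma0 s0; rewrite /lognormal_pdf s0 mulNr neg_ln_div_expR 1?addrC//.
by rewrite !mulr_gt0// sqrtr_gt0 mulr_gt0 ?pi_gt0.
Qed.

(** On the positive reals the factor [s^-1] is [exp (- ln s)], which reduces
    measurability to that of [exp] and [ln]. *)
Lemma measurable_lognormal_pdf sigma :
  measurable_fun setT (lognormal_pdf sigma).
Proof.
have -> : lognormal_pdf sigma = fun s => if 0 < s then
    (Num.sqrt (2 * pi) * sigma)^-1 *
      expR (- ln s - ln s ^+ 2 / (2 * sigma ^+ 2)) else 0.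
  apply/funext => s; rewrite /lognormal_pdf; case: ifPn => // s0.
  by rewrite [in LHS]invfM mulNr [in RHS]expRD [expR (- ln s)]expRN lnK ?posrE// -mulrA.
apply: measurable_fun_ifT => //; first exact: measurable_fun_ltr.
apply: measurable_funM => //; apply: measurableT_comp => //.
apply: measurable_funB.
  by apply: measurableT_comp => //; exact: measurable_ln.
by apply: measurable_funM => //; apply: measurable_funX; exact: measurable_ln.
Qed.

End densities.

Theorem theorem1 (R : realType) (d n m N : nat) (N_gt0 : (0 < N)%N)
  (Omega : set 'rV[R]_d) (Omega_open : open Omega) (tT : R)
  (u : 'rV[R]_d -> R -> 'rV[R]_n -> 'rV[R]_m -> R[i])
  (x : 'I_N -> 'rV[R]_d) (t : 'I_N -> R)
  (x_in : forall i, Omega (x i)) (t_in : forall i, 0 < t i < tT)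
  (X Y : normedModType R)
  (resF : 'rV[R]_n -> 'rV[R]_m -> X) (resB : 'rV[R]_n -> X)
  (resI : 'rV[R]_n -> Y) (lamF lamE muF muE : R)
  (disp : measure_display) (T : measurableType disp) (P : probability T R)
  (eps : 'I_N -> {RV P >-> R})
  (sigma gamma : R) (sigma_gt0 : 0 < sigma) (gamma_gt0 : 0 < gamma) :
  let pred := fun i theta v => u (x i) (t i) theta v in
  let loss := alm_loss resF resB resI lamF lamE muF muE in
  [/\ normal_error eps sigma ->
      data_term_rule pred loss eps (normal_pdf 0 sigma)
        (real_difference pred) (ln (sigma * Num.sqrt (2 * pi)))
        (normal_term sigma) /\
      (sigma ^+ 2 = 1 / 2 -> forall y theta v,
         normal_term sigma (residual pred y theta v) =
         two_norm_term (residual pred y theta v)),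
      laplace_error eps gamma ->
      data_term_rule pred loss eps (laplace_pdf gamma)
        (real_difference pred) (ln (2 * gamma)) (laplace_term gamma) /\
      (gamma = 1 -> forall y theta v,
         laplace_term gamma (residual pred y theta v) =
         one_norm_term (residual pred y theta v)) &
      lognormal_error eps sigma ->
      data_term_rule pred loss eps (lognormal_pdf sigma)
        (fun y theta v => real_difference pred y theta v /\
           forall i, 0 < residual pred y theta v i)
        0 (lognormal_term sigma)].
Proof.
move=> pred loss.
have loss_local LE LE' theta v : LE theta v = LE' theta v ->
    loss LE theta v = loss LE' theta v.
  by rewrite /loss /alm_loss => ->.
split=> [epsP|epsP|epsP].
- split=> [|sigma2 y theta v]; last first.
    congr (_ * _); apply: eq_bigr => i _.
    by rewrite sigma2 mul1r divff ?divr1 ?pnatr_eq0.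
  apply: (data_term_rule_of_density (l := fun s => s ^+ 2 / (2 * sigma ^+ 2))) => //.
  + exact: measurable_normal_pdf.
  + exact: normal_pdf_ge0.
  + by move=> s _; exact: neg_ln_normal_pdf.
  + by move=> y theta v; split=> [|[]//]; split=> // i; exact: normal_pdf_gt0.
- split=> [|-> y theta v]; last first.
    by congr (_ * _); apply: eq_bigr => i _; rewrite divr1.
  apply: (data_term_rule_of_density (l := fun s => `|s| / gamma)) => //.
  + exact: measurable_laplace_pdf.
  + by move=> s; rewrite ltW// laplace_pdf_gt0.
  + by move=> s _; exact: neg_ln_laplace_pdf.
  + by move=> y theta v; split=> [|[]//]; split=> // i; exact: laplace_pdf_gt0.
- apply: (data_term_rule_of_density (l := fun s => ln (Num.sqrt (2 * pi) * sigma * s) +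
              ln s ^+ 2 / (2 * sigma ^+ 2))) => //.
  + exact: measurable_lognormal_pdf.
  + by move=> s; exact: lognormal_pdf_ge0.
  + move=> s; rewrite lognormal_pdf_gt0// addr0.
    exact: neg_ln_lognormal_pdf.
  + move=> y theta v; split=> -[yr r_gt0]; split=> // i; have := r_gt0 i.
      by rewrite lognormal_pdf_gt0.
    by rewrite lognormal_pdf_gt0.
Qed.
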